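(* Let $C\in\mathbb{N}$ with $C>1$. Let $\Xi$ denote the number of pairs of sequences $$\left(\left\lfloor\frac{n-\delta}{\alpha}\right\rfloor\right)_{n\in\mathbb{N}},\qquad \left(\left\lfloor\frac{n-\gamma}{\beta}\right\rfloor\right)_{n\in\mathbb{N}}$$ arising from real numbers $\alpha,\beta,\delta,\gamma$ with $0<\alpha\le\beta$ such that $\alpha+\beta=1$, $\alpha$ is rational, the least positive integer $q$ with $q\alpha\in\mathbb{N}$ equals $C$, and $$\frac1q\le\alpha+\delta\le 1,\qquad \lceil q\delta\rceil+\lceil q\gamma\rceil=1 .$$ Then $\Xi$ is finite, and $\Xi=C\times(\varphi(C)+1)/2$.
   Context: $\mathbb{N}=\{1,2,3,\dots\}$. $\varphi(C)$ denotes the number of positive integers coprime with and less than $C$.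
   Formalization: The factor (φ(C)+1)/2 is read with a floor, so Ξ = C × ⌊(φ(C)+1)/2⌋; the formula as printed fails for every C > 2 (for C = 3 it gives 9/2, while Ξ = 3). *)

(* Defs.v *)
From mathcomp Require Import all_boot all_order all_algebra.
From mathcomp Require Import all_classical all_reals.
Set Implicit Arguments.
Unset Strict Implicit.
Unset Printing Implicit Defensive.
Import Order.TTheory GRing.Theory Num.Theory.

Local Open Scope classical_set_scope.
Local Open Scope ring_scope.

(* The positive integers, as a subset of R. *)
Definition posnat (R : realType) : set R :=
  [set x | exists2 m : nat, (0 < m)%N & x = m%:R].

Definition least_multiplier (R : realType) (alpha : R) (q : nat) : Prop :=
  [/\ (0 < q)%N, posnat (q%:R * alpha)
    & forall k : nat, (0 < k)%N -> posnat (k%:R * alpha) -> (q <= k)%N].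

(* Sequences are indexed by the positive integers: the value at i : nat is
   the term of index n = i + 1. *)
Definition beatty (R : realType) (alpha delta : R) : nat -> int :=
  fun i => Num.floor ((i.+1%:R - delta) / alpha).

Definition admissible (R : realType) (q : nat) (alpha beta delta gamma : R) :
    Prop :=
  [/\ 0 < alpha <= beta, alpha + beta = 1, rational alpha,
      least_multiplier alpha q
    & q%:R^-1 <= alpha + delta <= 1 /\
      Num.ceil (q%:R * delta) + Num.ceil (q%:R * gamma) = 1].

Definition beatty_pairs (R : realType) (q : nat) :
    set ((nat -> int) * (nat -> int)) :=
  [set s | exists alpha beta delta gamma : R,
     admissible q alpha beta delta gamma /\
     s = (beatty alpha delta, beatty beta gamma)].

(* Main.v *)
Require Import Defs.
From mathcomp Require Import all_boot all_order all_algebra.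
From mathcomp Require Import all_classical all_reals.
From mathcomp Require Import zify ring lra.

Import Order.TTheory GRing.Theory Num.Theory.

Local Open Scope classical_set_scope.
Local Open Scope card_scope.
Local Open Scope ring_scope.

(** Write [q = C]. The conditions on [alpha] say that [alpha = p / q] with [p]
    coprime to [q] and [2 p <= q]; then [beta = (q - p) / q]. Since nested
    floors collapse, [floor ((n - delta) / alpha)] equals
    [floor ((q n - d) / p)], where [d = ceil (q delta)], and likewise for the
    second sequence, with [1 - d] and [q - p] in place of [d] and [p]. So the
    pair of sequences depends only on [(p, d)], and the constraint on
    [alpha + delta] reads [1 - p <= q delta <= q - p], so that [d] takes the
    [q] integer values from [1 - p] to [q - p] for each [p]
    ([beatty_pairsE]).

    Conversely the first sequence alone determines [(p, d)]
    ([lattice_seq_inj]): it grows by [q] over each [p] consecutive indices,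
    which gives [p]; and since [q] is invertible modulo [p], some [n] makes
    [p] divide [q n - d], at which point any larger [d] gives a smaller floor.

    It remains to count the numerators [p] ([card_numerators]): for [q > 2]
    the involution [p |-> q - p] exchanges the residues coprime to [q] below
    and above [q / 2], so there are [totient q / 2] of them, while [q = 2]
    leaves only [p = 1]. *)

(** * Floor sequences with rational slope *)

(** The sequence [floor ((q n - d) / p)] for [n = i + 1], in integer
    arithmetic. *)
Definition lattice_seq (q p : nat) (d : int) : nat -> int :=
  fun i => ((q%:Z * i.+1%:Z - d) %/ p%:Z)%Z.

Lemma lattice_seq_shift (q p : nat) (d : int) (k i : nat) : (0 < p)%N ->
  lattice_seq q p d (i + k * p)%N = k%:Z * q%:Z + lattice_seq q p d i.
Proof.
move=> p0; rewrite /lattice_seq -divzMDl; last by lia.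
by congr divz; rewrite -addSn PoszD PoszM; ring.
Qed.

(** Both sequences grow over [p * p'] consecutive indices, by [p' * q] and
    [p * q] respectively. *)
Lemma lattice_seq_inj_den (q p p' : nat) (d d' : int) :
  (0 < q)%N -> (0 < p)%N -> (0 < p')%N ->
  lattice_seq q p d = lattice_seq q p' d' -> p = p'.
Proof.
move=> q0 p0 p'0 E.
have := lattice_seq_shift q p d p' 0 p0.
rewrite E mulnC lattice_seq_shift // => /addIr; nia.
Qed.

(** If [d < d'], the sequences differ at an index where [p] divides
    [q n - d]. *)
Lemma lattice_seq_inj_num_le (q p : nat) (d d' : int) :
  (0 < p)%N -> coprime q p ->
  lattice_seq q p d = lattice_seq q p d' -> d' <= d.
Proof.
move=> p0 cqp E; rewrite leNgt; apply/negP => dd'.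
have /coprimezP[[u v] /= uv] : coprimez q%:Z p%:Z by [].
(* [u] inverts [q] modulo [p]; a multiple of [p] is added to make the index
   [n] positive. *)
pose n := u * d + p%:Z * (`|u * d| + 1).
have n0 : 0 < n by rewrite /n; nia.
have nE : n = (`|n|%N.-1).+1%:Z by lia.
pose m := q%:Z * (`|u * d| + 1) - v * d.
have qn : q%:Z * n - d = m * p%:Z.
  apply/eqP; rewrite -subr_eq0 (_ : _ - _ = (u * q%:Z + v * p%:Z - 1) * d).
    by rewrite uv subrr mul0r.
  by rewrite /n /m; ring.
have /(congr1 (fun s => s `|n|%N.-1)) := E.
rewrite /lattice_seq -nE qn mulzK; last by lia.
by apply/eqP; rewrite gt_eqF // ltz_divLR; lia.
Qed.

Lemma lattice_seq_inj (q p p' : nat) (d d' : int) :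
  (0 < q)%N -> (0 < p)%N -> (0 < p')%N -> coprime q p ->
  lattice_seq q p d = lattice_seq q p' d' -> p = p' /\ d = d'.
Proof.
move=> q0 p0 p'0 cqp E.
have pp' := @lattice_seq_inj_den q p p' d d' q0 p0 p'0 E; subst p'; split=> //.
apply/eqP; rewrite eq_le.
by rewrite !(@lattice_seq_inj_num_le q p).
Qed.

(** For a rational slope only the ceiling of [q * delta] matters. *)
Lemma beattyE (R : realType) (q p : nat) (alpha delta : R) :
  (0 < q)%N -> (0 < p)%N -> alpha = p%:R / q%:R ->
  beatty alpha delta = lattice_seq q p (Num.ceil (q%:R * delta)).
Proof.
move=> q0 p0 ->; apply/funext => i; rewrite /beatty /lattice_seq.
have q0R : 0 < q%:R :> R by rewrite ltr0n.
have p0R : 0 < p%:R :> R by rewrite ltr0n.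
set d := Num.ceil _; set N := (q%:Z * _ - d).
have -> : (i.+1%:R - delta) / (p%:R / q%:R)
    = (q%:R * i.+1%:R - q%:R * delta) / p%:R :> R.
  by field; rewrite !gt_eqF.
have /andP[d1 d2] := ceil_itv (q%:R * delta).
rewrite -/d in d1 d2.
have NE : N%:~R = q%:R * i.+1%:R - d%:~R :> R.
  by rewrite /N intrD intrM rmorphN.
rewrite intrB in d1.
apply: floor_def; apply/andP; split.
  rewrite ler_pdivlMr //.
  have : (((N %/ p)%Z * p)%:~R <= N%:~R :> R).
    by rewrite ler_int lez_floor //; lia.
  rewrite intrM NE -[(p%:Z)%:~R]/(p%:R); lra.
rewrite ltr_pdivrMr //.
(* Strictness survives the rounding because [N + 1] is still at most the next
   multiple of [p]. *)
have : ((N + 1)%:~R <= (((N %/ p)%Z + 1) * p)%:~R :> R).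
  by rewrite ler_int lezD1 ltz_ceil //; lia.
rewrite intrM (intrD _ N) NE -[(p%:Z)%:~R]/(p%:R); lra.
Qed.

(** * Parametrization by numerator and offset *)

(** The least multiplier of [alpha] is the reduced denominator of [alpha]. *)
Lemma least_multiplier_fracP (R : realType) (q : nat) (alpha : R) :
  least_multiplier alpha q <->
  exists p : nat, [/\ (0 < q)%N, (0 < p)%N, coprime q p & alpha = p%:R / q%:R].
Proof.
split.
  case=> q0 [p p0 qa] qmin; exists p.
  have q0R : q%:R != 0 :> R by rewrite pnatr_eq0; lia.
  have aE : alpha = p%:R / q%:R by rewrite -qa; field.
  split=> //.
  have g0 : (0 < gcdn q p)%N by rewrite gcdn_gt0 q0.
  have /dvdnP[k] := dvdn_gcdl q p; have /dvdnP[m] := dvdn_gcdr q p.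
  rewrite /coprime; move: (gcdn q p) g0 => g g0 mE kE.
  have k0 : (0 < k)%N by lia.
  have qk : (q <= k)%N.
    apply: qmin => //; exists m; first by lia.
    rewrite aE mE kE !natrM; field.
    by rewrite !pnatr_eq0; lia.
  by apply/eqP; nia.
case=> p [q0 p0 cqp aE].
have q0R : q%:R != 0 :> R by rewrite pnatr_eq0; lia.
split=> //.
  by exists p => //; rewrite aE; field.
move=> k k0 [m m0 kE].
have : (k * p)%:R = (m * q)%:R :> R by rewrite !natrM -kE aE; field.
move/eqP; rewrite eqr_nat => /eqP kpE.
apply: dvdn_leq => //.
by rewrite -(Gauss_dvdl _ cqp) kpE dvdn_mull.
Qed.

(** The numerators [p] of the fractions [p / q] in lowest terms that are at
    most one half; [p = 0] is excluded by coprimality as soon as [1 < q]. *)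
Definition numerators (q : nat) : {set 'I_q} :=
  [set p : 'I_q | coprime q p && (2 * p <= q)%N].

(** The pair of sequences with numerator [x.1]; the offset [x.2] enumerates
    the admissible values [1 - p, ..., q - p] of [ceil (q * delta)]. *)
Definition lattice_pair (q : nat) (x : 'I_q * 'I_q) :
    (nat -> int) * (nat -> int) :=
  let d := 1 - x.1%:Z + x.2%:Z in
  (lattice_seq q x.1 d, lattice_seq q (q - x.1) (1 - d)).

Lemma coprime_gt0 (q p : nat) : (1 < q)%N -> coprime q p -> (0 < p)%N.
Proof. by case: p => // q1; rewrite /coprime gcdn0 => /eqP; lia. Qed.

Lemma beatty_pairsE (R : realType) (q : nat) : (1 < q)%N ->
  @beatty_pairs R q = [set lattice_pair q x | x in
    [set x | x \in finset.setX (numerators q) [set: 'I_q]%SET]].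
Proof.
move=> q1; have q0 : (0 < q)%N by lia.
have q0R : 0 < q%:R :> R by rewrite ltr0n.
apply/seteqP; split=> s /=.
  case=> alpha [beta [delta [gamma [adm ->]]]].
  case: adm => /andP[a0 ab] ab1 _ lm [/andP[dl du] ceilE].
  have [p [_ p0 cqp aE]] := (least_multiplier_fracP _ _ _).1 lm.
  have qa : q%:R * alpha = p%:R by rewrite aE; field; rewrite gt_eqF.
  have pq : (2 * p <= q)%N.
    rewrite -(@ler_nat R) natrM -qa; nra.
  have pltq : (p < q)%N by lia.
  have bE : beta = (q - p)%:R / q%:R.
    have -> : beta = 1 - alpha by lra.
    by rewrite natrB 1?ltnW // aE; field; rewrite gt_eqF.
  have qd : 1 <= p%:R + q%:R * delta <= q%:R.
    rewrite -qa -mulrDr -[X in X <= _ <= _](mulfV (lt0r_neq0 q0R)).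
    by rewrite ler_pM2l // dl ler_piMr // ltW.
  case/andP: qd => qd1 qd2; move: ceilE; set d := Num.ceil _ => ceilE.
  have d1 : 1 - p%:Z <= d.
    rewrite -(ler_int R); have := ceil_ge (q%:R * delta); rewrite -/d.
    by rewrite intrB -[(p%:Z)%:~R]/(p%:R); lra.
  have d2 : d <= q%:Z - p%:Z.
    rewrite ceil_le_int intrB -[(p%:Z)%:~R]/(p%:R) -[(q%:Z)%:~R]/(q%:R); lra.
  have klt : (`|(d - (1 - p%:Z))%R| < q)%N by lia.
  exists (Ordinal pltq, Ordinal klt).
    by rewrite !inE /= cqp pq.
  rewrite (@beattyE R q p) // (@beattyE R q (q - p)) //; last by lia.
  rewrite /lattice_pair /= -/d.
  by congr (lattice_seq _ _ _, lattice_seq _ _ _); lia.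
case=> -[p k]; rewrite !inE /= andbT => /andP[cqp pq] <-.
have p0 := coprime_gt0 _ _ q1 cqp.
have pltq := ltn_ord p; have kltq := ltn_ord k.
rewrite /lattice_pair /=; set d := (1 - _ + _).
(* The representative with [q * delta] and [q * gamma] integers. *)
pose alpha : R := p%:R / q%:R; pose beta : R := (q - p)%:R / q%:R.
exists alpha, beta, (d%:~R / q%:R), ((1 - d)%:~R / q%:R).
have qM (z : int) : q%:R * (z%:~R / q%:R) = z%:~R :> R.
  by field; rewrite gt_eqF.
split; last first.
  rewrite (@beattyE R q p) // (@beattyE R q (q - p)) ?subn_gt0 //.
  by rewrite !qM !intrKceil.
split.
- by rewrite divr_gt0 ?ltr0n //= ler_pM2r ?invr_gt0 // ler_nat; lia.
- by rewrite -mulrDl -natrD subnKC ?mulfV ?gt_eqF // ltnW.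
- by apply/rationalP; exists p%:Z, q.
- by apply/least_multiplier_fracP; exists p.
- split; last by rewrite !qM !intrKceil; lia.
  have -> : alpha + d%:~R / q%:R = (1 + k%:R) / q%:R.
    rewrite -mulrDl /d intrD intrB -[(p%:Z)%:~R]/(p%:R) -[(k%:Z)%:~R]/(k%:R).
    by congr (_ / _); ring.
  rewrite ler_peMl ?invr_ge0 ?(ltW q0R) ?lerDl ?ler0n //=.
  by rewrite ler_pdivrMr // mul1r addrC natr1 ler_nat.
Qed.

Lemma lattice_pair_inj (q : nat) : (1 < q)%N ->
  {in finset.setX (numerators q) [set: 'I_q]%SET &, injective (@lattice_pair q)}.
Proof.
move=> q1 [p k] [p' k']; rewrite !inE /= !andbT.
move=> /andP[cqp _] /andP[cqp' _] [E _].
have q0 : (0 < q)%N by lia.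
have [pp' dd'] := lattice_seq_inj _ _ _ _ _ q0 (coprime_gt0 _ _ q1 cqp)
  (coprime_gt0 _ _ q1 cqp') cqp E.
by congr pair; apply: val_inj => /=; lia.
Qed.

(** * Counting *)

Lemma coprime_subr (m n : nat) : (n <= m)%N ->
  coprime m (m - n) = coprime m n.
Proof.
move/subnK; move: (m - n)%N => r <-.
by rewrite /coprime gcdnC gcdnDl [in RHS]gcdnC gcdnDr gcdnC.
Qed.

Lemma card_numerators (q : nat) : (1 < q)%N ->
  #|numerators q| = ((totient q + 1) %/ 2)%N.
Proof.
move=> q1; have [q2|q2] := eqVneq q 2%N.
  (* Here [p = 1] is fixed by [p |-> q - p]. *)
  rewrite q2 /= (_ : numerators 2 = [set Ordinal (isT : (1 < 2)%N)]%SET).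
    by rewrite cards1.
  by apply/setP => -[[|[|//]] i]; rewrite !inE.
have q3 : (2 < q)%N by lia.
pose A := [set p : 'I_q | coprime q p]%SET.
have totA : totient q = #|A|.
  rewrite totient_count_coprime big_mkord -sum1_card [RHS]big_mkcond /=.
  by apply: eq_bigr => i _; rewrite inE; case: coprime.
(* The value at [p = 0] is irrelevant, since [0] is not coprime to [q]. *)
pose f (p : 'I_q) : 'I_q := insubd p (q - p)%N.
have fE p : p \in A -> f p = (q - p)%N :> nat.
  rewrite inE => /(coprime_gt0 _ _ q1) p0.
  by rewrite /f val_insubd ifT //; have := ltn_ord p; lia.
have fA p : p \in A -> f p \in A.
  move=> pA; have := pA; rewrite !inE fE // coprime_subr //.
  exact/ltnW/ltn_ord.
have sub : numerators q \subset A.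
  by apply/fintype.subsetP => p; rewrite !inE => /andP[].
have half p : p \in A -> (2 * p != q)%N.
  rewrite inE => cqp; apply/eqP => pq.
  have /coprime_dvdl/(_ cqp) : (p %| q)%N.
    by rewrite -[X in (_ %| X)%N]pq dvdn_mull.
  by rewrite /coprime gcdnn => /eqP; lia.
have cardC : #|A :\: numerators q| = #|numerators q|.
  have -> : (A :\: numerators q = f @: numerators q)%SET.
    apply/setP => p; apply/idP/imsetP.
      rewrite inE => /andP[pN pA]; exists (f p).
        have := fA _ pA; rewrite !inE => ->; rewrite fE //=.
        by move: pA pN; rewrite !inE => -> /=; lia.
      apply: val_inj => /=; rewrite !fE ?fA //; have := ltn_ord p; lia.
    case=> r rN ->; have rA := fintype.subsetP sub _ rN.
    rewrite inE fA // andbT inE negb_and fE //; apply/orP; right.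
    by move: rN (half _ rA); rewrite inE => /andP[_]; lia.
  rewrite card_in_imset // => x y.
  move=> /(fintype.subsetP sub) xA /(fintype.subsetP sub) yA.
  move=> /(congr1 val) /=; rewrite !fE // => E; apply: val_inj => /=.
  by have := ltn_ord x; have := ltn_ord y; lia.
by rewrite totA -(cardsID (numerators q) A) cardC (finset.setIidPr sub); lia.
Qed.

(* The quotient is the integer quotient: for C > 2, totient C is even. *)
Theorem proposition2 (R : realType) (C : nat) (hC : (1 < C)%N) :
  finite_set (@beatty_pairs R C) /\
  @beatty_pairs R C #= `I_(C * ((totient C + 1) %/ 2))%N.
Proof.
have cardE : @beatty_pairs R C #= `I_(C * ((totient C + 1) %/ 2))%N.
  rewrite beatty_pairsE //; set D := finset.setX _ _.
  have -> : (C * ((totient C + 1) %/ 2) = #|D|)%N.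
    by rewrite cardsX cardsT card_ord card_numerators // mulnC.
  have -> : [set x | x \in D] = [set enum_val i | i in [set: 'I_#|D|]].
    apply/seteqP; split=> x /=; last by case=> i _ <-; exact: enum_valP.
    by move=> xD; exists (enum_rank_in xD x) => //; rewrite enum_rankK_in.
  rewrite image_comp (card_eq_trans _ (card_esym card_II)) //.
  apply: inj_card_eq => i j _ _ /(lattice_pair_inj _ hC).
  by move=> /(_ (enum_valP i) (enum_valP j)) /enum_val_inj.
by split=> //; apply/finite_setP; eexists; exact: cardE.
Qed.
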